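(* Let $N\ge 2$ be a fixed integer and consider the undamped ($\gamma=0$) discrete nonlinear Schrödinger system in a rotating frame $$-i\,\frac{\partial w_j}{\partial t} = -\epsilon\,(\Delta w)_j - w_j + |w_j|^2 w_j,\qquad j=1,\dots,N,$$ for $w=(w_1,\dots,w_N)\in\mathbb{C}^N$. There exists $\epsilon_0>0$ such that for all $0<\epsilon<\epsilon_0$ this system has a unique real-valued fixed point $w^*=(w_1^*,\dots,w_N^* )\in\mathbb{R}^N$ with $w_1^* = 1+\mathcal{O}(\epsilon)$ and $w_j^*=\mathcal{O}(\epsilon^{j-1})$ for $j=2,\dots,N$.
   Context: The discrete Laplacian on the finite chain $\{1,\dots,N\}$ is $(\Delta w)_j = w_{j-1}-2w_j+w_{j+1}$ for $1<j<N$, with free ends: $(\Delta w)_1 = w_2-w_1$ and $(\Delta w)_N = w_{N-1}-w_N$. A fixed point is a time-independent solution, i.e. a vector $w^*\in\mathbb{C}^N$ with $-\epsilon(\Delta w^* )_j - w_j^* + |w_j^*|^2w_j^*=0$ for all $j=1,\dots,N$; it is real-valued if all $w_j^*\in\mathbb{R}$. The $\mathcal{O}$ notation refers to $\epsilon\to0^+$ with $N$ fixed and constants independent of $\epsilon$: the assertion is that there are constants $\epsilon_0>0$ and $C>0$ (depending only on $N$) such that for each $0<\epsilon<\epsilon_0$ there is exactly one real-valued fixed point satisfying $|w_1^*-1|\le C\epsilon$ and $|w_j^*|\le C\epsilon^{j-1}$ for $j=2,\dots,N$. *)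

(* Defs.v *)
From HB Require Import structures.
From mathcomp Require Import all_boot all_order all_algebra.
From mathcomp Require Import all_classical all_reals all_analysis.
From mathcomp Require Export complex.
Import Order.TTheory GRing.Theory Num.Theory.
Import numFieldNormedType.Exports.

Set Implicit Arguments.
Unset Strict Implicit.
Unset Printing Implicit Defensive.

Local Open Scope ring_scope.
Local Open Scope complex_scope.

(* The sites 1, ..., N of the chain are the ordinals 0, ..., N.-1 of 'I_N. *)

(* [ord_pred] and [ordS] are cyclic, but the case distinction on the ends of
   the chain ensures that they never wrap around when 2 <= N, so they are just
   the left and right neighbours j - 1 and j + 1. *)
Definition laplacian (R : realType) (N : nat) (w : 'rV[R[i]]_N) (j : 'I_N)
    : R[i] :=
  if j == 0%N :> nat then w ord0 (ordS j) - w ord0 j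
  else if j == N.-1 :> nat then w ord0 (ord_pred j) - w ord0 j
  else w ord0 (ord_pred j) - 2 * w ord0 j + w ord0 (ordS j).

Definition dnls_rhs (R : realType) (N : nat) (eps : R) (w : 'rV[R[i]]_N)
    (j : 'I_N) : R[i] :=
  - eps%:C * laplacian w j - w ord0 j + `|w ord0 j| ^+ 2 * w ord0 j.

(* Derivative of a complex-valued function of a real variable. *)
Definition is_cderive (R : realType) (f : R -> R[i]) (t : R) (d : R[i]) :=
  is_derive t 1 (fun s => complex.Re (f s)) (complex.Re d) /\
  is_derive t 1 (fun s => complex.Im (f s)) (complex.Im d).

Definition dnls_solution (R : realType) (N : nat) (eps : R)
    (w : R -> 'rV[R[i]]_N) :=
  forall (t : R) (j : 'I_N), exists2 d : R[i],
    is_cderive (fun s => w s ord0 j) t d & - 'i%C * d = dnls_rhs eps (w t) j.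

Definition fixed_point (R : realType) (N : nat) (eps : R) (w : 'rV[R[i]]_N) :=
  dnls_solution eps (fun=> w).

Lemma fixed_pointP (R : realType) (N : nat) (eps : R) (w : 'rV[R[i]]_N) :
  fixed_point eps w <-> forall j : 'I_N, dnls_rhs eps w j = 0.
Proof.
split=> [fw j|w0 t j]; last first.
  exists 0; last by rewrite mulr0 w0.
  by split; apply: is_derive_cst.
have [d [dRe dIm] <-] := fw 0 j.
suff -> : d = 0 by rewrite mulr0.
apply/eqP; rewrite eq_complex; apply/andP; split; apply/eqP => /=.
- by rewrite -(@derive_val _ _ _ _ _ _ _ dRe) derive_cst.
- by rewrite -(@derive_val _ _ _ _ _ _ _ dIm) derive_cst.
Qed.

Definition real_valued (R : realType) (N : nat) (w : 'rV[R[i]]_N) :=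
  forall j : 'I_N, complex.Im (w ord0 j) = 0.

(* The bounds |w_1 - 1| <= C eps and |w_j| <= C eps^(j-1), j = 2, ..., N; the
   exponent is j because of the shift of indices. *)
Definition near_single_site (R : realType) (N : nat) (C eps : R)
    (w : 'rV[R[i]]_N) :=
  forall j : 'I_N,
    if j == 0%N :> nat then `|w ord0 j - 1| <= (C * eps)%:C
    else `|w ord0 j| <= (C * eps ^+ j)%:C.

(* Main.v *)
(* For a real vector the fixed point equation reads f(x_j) = eps (Delta x)_j with
   f(a) = a^3 - a. Preconditioned by the inverse of f' at (1, 0, ..., 0), it is the
   fixed point equation of a map which, for small eps, contracts the sup norm
   on the ball of radius 1/8 around (1, 0, ..., 0); this gives uniqueness. The
   map preserves the box |x_1 - 1| <= 4 eps, |x_j| <= (4 eps)^(j-1), because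
   the dominant coupling eps x_(j-1) gains a factor eps from one site to the
   next and the constant 4 absorbs the remaining terms, so Banach's theorem
   gives existence, with C = 4^N. *)

From HB Require Import structures.
Require Import Defs.
From mathcomp Require Import all_boot all_order all_algebra.
From mathcomp Require Import all_classical all_reals all_analysis.
From mathcomp Require Import ring lra zify.
Import Order.TTheory GRing.Theory Num.Theory.
Import numFieldNormedType.Exports.
Local Open Scope ring_scope.
Local Open Scope complex_scope.

Set Implicit Arguments.
Unset Strict Implicit.
Unset Printing Implicit Defensive.

(* Matrices are already complete and normed; this only declares the join. *)
HB.instance Definition _ (R : realType) m n := Complete.on 'M[R]_(m, n).

(** * Sup norm and closed boxes *)

Lemma mx_norm_leP (R : realType) m n (x : 'M[R]_(m, n)) (e : R) : 0 <= e ->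
  (`|x| <= e) <-> (forall i j, `|x i j| <= e).
Proof.
move=> e0; rewrite [`|x|]/Num.norm /= mx_normrE.
split=> [/bigmax_leP[_ h] i j|h]; first exact: (h (i, j)).
by apply/bigmax_leP; split=> // -[i j] _; exact: h.
Qed.

Lemma closed_rV_box (R : realType) n (c r : 'I_n -> R) :
  closed [set x : 'rV[R]_n | forall j, `|x ord0 j - c j| <= r j]%classic.
Proof.
rewrite (_ : [set _ | _]%classic = \bigcap_j
    ((fun x : 'rV[R]_n => `|x ord0 j - c j|) @^-1` [set y | y <= r j]))%classic.
  apply: closed_bigI => j _; apply: preimage_closed; last exact: closed_le.
  move=> x _; apply: (@continuous_comp _ _ _
    (fun x : 'rV[R]_n => x ord0 j - c j) Num.norm).
    by apply: continuousB; [exact: coord_continuous|exact: cst_continuous].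
  exact: norm_continuous.
by apply/seteqP; split=> x /= h j; [move=> _; exact: h|exact: h].
Qed.

Lemma normc_real (R : rcfType) (a : R) : `|a%:C| = `|a|%:C.
Proof. by rewrite normc_def /= expr0n /= addr0 sqrtr_sqr. Qed.

(** * Cubic estimates near the zeros 0 and 1 of a^3 - a *)

(** This is the cofactor of a - b in a^3 - b^3; near 1 it is applied to a - 1 and b - 1. *)
Lemma norm_quad_le (R : realFieldType) (a b : R) :
  `|a| <= 1/8 -> `|b| <= 1/8 -> `|a ^+ 2 + a * b + b ^+ 2| <= 3/64.
Proof.
move=> ha hb; apply: (le_trans (ler_normD _ _)).
have := ler_normD (a ^+ 2) (a * b); rewrite !expr2 !normrM.
have := ler_pM (normr_ge0 _) (normr_ge0 _) ha ha.
have := ler_pM (normr_ge0 _) (normr_ge0 _) ha hb.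
have := ler_pM (normr_ge0 _) (normr_ge0 _) hb hb.
lra.
Qed.

(** Without coupling, the preconditioned map at a site near 0 is a + (a^3 - a) = a^3. *)
Lemma dist_cube_near0 (R : realFieldType) (a b : R) :
  `|a| <= 1/8 -> `|b| <= 1/8 -> `|a ^+ 3 - b ^+ 3| <= 1/2 * `|a - b|.
Proof.
move=> ha hb.
rewrite (_ : _ - _ = (a ^+ 2 + a * b + b ^+ 2) * (a - b)); last by ring.
by rewrite normrM ler_wpM2r// (le_trans (norm_quad_le ha hb))//; lra.
Qed.

(** With u = a - 1 the map is 1 - (3 u^2 + u^3) / 2, which has no linear term; its Lipschitz
    constant for |u| <= 1/8 is at most (3/4 + 3/64) / 2 < 1/2. *)
Lemma dist_newton_cube_near1 (R : realFieldType) (a b : R) :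
  `|a - 1| <= 1/8 -> `|b - 1| <= 1/8 ->
  `|(a - 2^-1 * (a ^+ 3 - a)) - (b - 2^-1 * (b ^+ 3 - b))| <= 1/2 * `|a - b|.
Proof.
move=> ha hb; have := norm_quad_le ha hb.
rewrite (_ : a - _ - _ = (- (3 * ((a - 1) + (b - 1)) +
    ((a - 1) ^+ 2 + (a - 1) * (b - 1) + (b - 1) ^+ 2)) / 2) * (a - b));
  last by field.
move: (_ + _ + _ ^+ 2) => s hs.
rewrite normrM ler_wpM2r//; move: ha hb hs; rewrite !ler_norml; lra.
Qed.

(* [t] stands for [4 * eps], [a] and [b] for the sites 2 and 1 of the chain. *)
Lemma newton_near1_bound (R : realFieldType) (t a b : R) :
  0 < t <= 1/16 -> `|a| <= 1 + t -> `|b - 1| <= t ->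
  `|b - 2^-1 * (b ^+ 3 - b - t / 4 * (a - b)) - 1| <= t.
Proof.
move=> /andP[t0 t1] ha hb.
(* The linear term in b - 1 cancels. The two summands are at most t / 8 and 3 t / 8. *)
rewrite (_ : _ - 1 = - (3/2 + 2^-1 * (b - 1)) * (b - 1) ^+ 2 + t / 8 * (a - b));
  last by field.
apply: (le_trans (ler_normD _ _)); rewrite normrM normrX normrM.
rewrite (@gtr0_norm _ (t / 8)); last by rewrite divr_gt0.
have d3 : `|a - b| <= 3 by move: ha hb; rewrite !ler_norml; lra.
have c2 : `|- (3/2 + 2^-1 * (b - 1))| <= 2.
  by move: hb; rewrite !ler_norml; lra.
have b2 : `|b - 1| ^+ 2 <= 1/16 * t.
  by rewrite expr2 ler_pM// (le_trans hb).
have := ler_pM (normr_ge0 _) (exprn_ge0 2 (normr_ge0 _)) c2 b2.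
have : t / 8 * `|a - b| <= t / 8 * 3 by rewrite ler_pM2l// divr_gt0.
lra.
Qed.

(** * The quasi-Newton map on the real chain *)

Definition real_laplacian (R : pzRingType) (N : nat) (x : 'rV[R]_N) (j : 'I_N)
    : R :=
  if j == 0%N :> nat then x ord0 (ordS j) - x ord0 j
  else if j == N.-1 :> nat then x ord0 (ord_pred j) - x ord0 j
  else x ord0 (ord_pred j) - 2 * x ord0 j + x ord0 (ordS j).

Section RealChain.
Variables (R : realType) (N : nat).
Implicit Types (x y : 'rV[R]_N) (eps : R).

Lemma real_laplacianB x y j :
  real_laplacian (x - y) j = real_laplacian x j - real_laplacian y j.
Proof.
by rewrite /real_laplacian !mxE; case: ifP => _; [|case: ifP => _]; ring.
Qed.

Lemma real_laplacian_bound x j : `|real_laplacian x j| <= 4 * `|x|.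
Proof.
have h k : - `|x| <= x ord0 k <= `|x|.
  by rewrite -ler_norml; exact: (mx_norm_leP x (normr_ge0 x)).1.
have [[h1 h2] h3] := (h j, h (ordS j), h (ord_pred j)).
rewrite /real_laplacian ler_norml; case: ifP => _; [|case: ifP => _]; lra.
Qed.

Lemma laplacian_real x j :
  laplacian (map_mx (real_complex R) x) j = (real_laplacian x j)%:C.
Proof.
rewrite /laplacian /real_laplacian !mxE.
by case: ifP => _; [|case: ifP => _];
  rewrite !(rmorphB, rmorphD, rmorphM, rmorph_nat).
Qed.

Definition residual eps x (j : 'I_N) : R :=
  x ord0 j ^+ 3 - x ord0 j - eps * real_laplacian x j.

Lemma dnls_rhs_real eps x j :
  dnls_rhs eps (map_mx (real_complex R) x) j = (residual eps x j)%:C.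
Proof.
rewrite /dnls_rhs laplacian_real !mxE normc_real.
rewrite -rmorphN -!rmorphXn -!rmorphM -rmorphB -rmorphD real_normK ?num_real //.
congr (_ %:C); rewrite /residual; ring.
Qed.

(* The limit (1, 0, ..., 0) as eps -> 0. *)
Definition one_site (j : 'I_N) : R := (j == 0%N :> nat)%:R.

(* The step uses only the derivative of a^3 - a at the sites of [one_site], which
   is 2 at the first site and -1 at the others. *)
Definition quasi_newton eps x : 'rV[R]_N :=
  \row_j (x ord0 j - (if j == 0%N :> nat then 2^-1 else -1) * residual eps x j).

Lemma quasi_newton_fixed eps x :
  x = quasi_newton eps x <-> forall j, residual eps x j = 0.
Proof.
split=> [h j|h]; last by apply/rowP => j; rewrite !mxE h; case: ifP => _; ring.
move/rowP/(_ j) : h; rewrite !mxE; case: ifP => _; lra.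
Qed.

(** The cubic part contributes 1/2. The coupling contributes at most 4 * eps <= 1/4, since the
    preconditioner has entries of modulus at most 1. *)
Lemma quasi_newton_lipschitz eps x y : 0 <= eps <= 1/16 ->
  (forall j, `|x ord0 j - one_site j| <= 1/8) ->
  (forall j, `|y ord0 j - one_site j| <= 1/8) ->
  `|quasi_newton eps x - quasi_newton eps y| <= 3/4 * `|x - y|.
Proof.
move=> /andP[e0 e1] hx hy; apply/mx_norm_leP; first by rewrite mulr_ge0.
move=> i j; rewrite {i}(ord1 i) !mxE.
have lapB : `|eps * real_laplacian (x - y) j| <= 1/4 * `|x - y|.
  rewrite normrM (ger0_norm e0).
  apply: le_trans (ler_pM e0 (normr_ge0 _) e1 (real_laplacian_bound _ _)) _; lra.
have dB : `|(x - y) ord0 j| <= `|x - y|.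
  exact: (mx_norm_leP (x - y) (normr_ge0 _)).1.
rewrite real_laplacianB in lapB; rewrite !mxE in dB.
move: lapB dB (hx j) (hy j); rewrite /one_site /residual.
set l := real_laplacian x j; set m := real_laplacian y j.
case: ifP => _ /=; rewrite ?subr0 => lapB dB hxj hyj.
  have := dist_newton_cube_near1 hxj hyj.
  move: lapB; rewrite !ler_norml; lra.
have := dist_cube_near0 hxj hyj.
move: lapB; rewrite !ler_norml; lra.
Qed.

(** The exponent [maxn 1 j] treats all sites at once: the first site deviates from 1 by order eps,
    site [j] > 0 from 0 by order eps^j. *)
Lemma quasi_newton_invariant eps x : 0 < eps <= 1/64 ->
  (forall j, `|x ord0 j - one_site j| <= (4 * eps) ^+ maxn 1 j) ->
  (forall j, `|quasi_newton eps x ord0 j - one_site j| <= (4 * eps) ^+ maxn 1 j).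
Proof.
move=> /andP[e0 e1] hx j; set t := 4 * eps.
have t0 : 0 < t by rewrite /t; lra.
have t1 : t <= 1/16 by rewrite /t; lra.
have epst : eps = t / 4 by rewrite /t; field.
have pow_le n k : (n <= k)%N -> t ^+ k <= t ^+ n.
  by move=> nk; rewrite ler_wiXn2l //; lra.
have coarse k : `|x ord0 k| <= 1 + t.
  rewrite -[x _ _](subrK (one_site k)) (le_trans (ler_normD _ _))// addrC lerD//.
    by rewrite /one_site; case: (_ == _); rewrite ?normr1 ?normr0.
  apply: le_trans (hx k) _; rewrite -/t -[leRHS]expr1; apply: pow_le; lia.
rewrite !mxE /residual epst.
have hj := hx j; rewrite -/t in hj.
case: (eqVneq (j : nat) 0%N) hj => [j0|jN0].
  rewrite /one_site /real_laplacian j0 eqxx /= expr1.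
  by apply: newton_near1_bound; rewrite ?t0 ?t1.
rewrite /one_site (negPf jN0) !subr0 (_ : maxn 1 j = j); last lia.
have jgt0 : (0 < j)%N by lia.
(* Since [j] > 0, the cyclic predecessor does not wrap around. *)
have pred_val : ord_pred j = j.-1 :> nat.
  rewrite /= (_ : (j + N).-1 = j.-1 + N)%N; last lia.
  by rewrite modnDr modn_small// (leq_ltn_trans (leq_pred _)).
(* The factor 2 is for a left neighbour that is the first site: there the power is 1 and the value
   at most 1 + t. *)
have pred_le : `|x ord0 (ord_pred j)| <= 2 * t ^+ j.-1.
  have := hx (ord_pred j); rewrite -/t /one_site pred_val.
  case: (eqVneq j.-1 0%N) => [-> _|jp0] /=.
    rewrite expr0; have := coarse (ord_pred j); lra.
  rewrite subr0 (_ : maxn 1 j.-1 = j.-1); last lia.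
  have : 0 < t ^+ j.-1 by rewrite exprn_gt0.
  lra.
have succ_le : j != N.-1 :> nat -> `|x ord0 (ordS j)| <= t ^+ j.
  move=> jN; have succ_val : ordS j = j.+1 :> nat.
    by rewrite /= modn_small //; have := ltn_ord j; lia.
  have := hx (ordS j); rewrite -/t /one_site succ_val /= subr0.
  rewrite (_ : maxn 1 _ = j.+1)//; last lia.
  by move=> /le_trans; apply; apply: pow_le.
move=> hj.
set p := t ^+ j in hj succ_le *; set q := t ^+ j.-1 in pred_le.
have pq : p = t * q by rewrite /p /q -exprS prednK.
have q0 : 0 < q by rewrite exprn_gt0.
(* The left neighbour gives 2 q, the site itself at most 2 p and the right neighbour, if any, p. *)
have lap_le : `|real_laplacian x j| <= 2 * q + 3 * p.
  rewrite /real_laplacian (negPf jN0).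
  move: hj pred_le; rewrite !ler_norml => /andP[? ?] /andP[? ?].
  case: ifPn => [_|/succ_le]; rewrite ?ler_norml; lra.
rewrite (_ : x ord0 j - -1 * _ = x ord0 j ^+ 3 - t / 4 * real_laplacian x j);
  last by ring.
apply: (le_trans (ler_normB _ _)).
rewrite normrX normrM (ger0_norm (_ : 0 <= t / 4)); last lra.
have p_le : p <= t by rewrite -[leRHS]expr1 pow_le.
move: hj lap_le; set A := `|x _ _|; set L := `|_ x j|=> hj lap_le.
have A0 : 0 <= A by exact: normr_ge0.
have p0 : 0 < p by rewrite exprn_gt0.
have A16 : A <= 1/16 by exact: le_trans hj (le_trans p_le t1).
have A3 : A ^+ 3 <= p * (1/16 * (1/16)).
  by rewrite exprS expr2 !ler_pM// mulr_ge0.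
have tL : t / 4 * L <= t / 4 * (2 * q + 3 * p) by rewrite ler_pM2l//; lra.
have tp : t * p <= 1/16 * p by rewrite ler_pM2r.
(* As t * q = p, the total is at most p / 256 + p / 2 + 3 p / 64 < p; the left neighbour yields the
   p / 2, which is why t is 4 * eps. *)
rewrite pq in A3 tL tp *; lra.
Qed.

(** Both vectors are fixed by a 3/4-contraction. The ball of fixed radius, rather than the invariant
    box, lets this apply to competitors with the weaker bounds of the theorem. *)
Lemma residual0_unique eps x y : 0 <= eps <= 1/16 ->
  (forall j, `|x ord0 j - one_site j| <= 1/8) ->
  (forall j, `|y ord0 j - one_site j| <= 1/8) ->
  (forall j, residual eps x j = 0) -> (forall j, residual eps y j = 0) -> x = y.
Proof.
move=> heps hx hy /quasi_newton_fixed fx /quasi_newton_fixed fy.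
have := quasi_newton_lipschitz heps hx hy; rewrite -fx -fy => h.
by apply/eqP; rewrite -subr_eq0 -normr_le0; lra.
Qed.

Lemma residual0_exists eps : 0 < eps <= 1/64 ->
  exists2 x : 'rV[R]_N,
    forall j, `|x ord0 j - one_site j| <= (4 * eps) ^+ maxn 1 j &
    forall j, residual eps x j = 0.
Proof.
move=> heps; have /andP[e0 e1] := heps.
pose U := [set x : 'rV[R]_N |
  forall j, `|x ord0 j - one_site j| <= (4 * eps) ^+ maxn 1 j]%classic.
have fU : set_fun U U (quasi_newton eps).
  by move=> x; exact: quasi_newton_invariant.
have box8 (j : 'I_N) : (4 * eps) ^+ maxn 1 j <= 1/8.
  have : (4 * eps) ^+ maxn 1 j <= (4 * eps) ^+ 1.
    by rewrite ler_wiXn2l// ?leq_maxl//; lra.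
  by rewrite expr1; lra.
have ctr : is_contraction (mkfun_fun fU).
  exists (3/4)%:nng; split=> /=; first by lra.
  move=> [x y] /= [Ux Uy]; apply: quasi_newton_lipschitz => [|j|j].
  - lra.
  - exact: le_trans (Ux j) (box8 j).
  - exact: le_trans (Uy j) (box8 j).
have U0 : (U !=set0)%classic.
  exists (\row_j one_site j) => j.
  by rewrite mxE subrr normr0 exprn_ge0// mulr_ge0// ltW.
have [x Ux fx] := banach_fixed_point ctr (@closed_rV_box R N _ _) U0.
by exists x => //; exact/quasi_newton_fixed.
Qed.

End RealChain.

(** * Transfer from the real chain to the complex system *)

Theorem theorem2p1 (R : realType) (N : nat) (hN : (2 <= N)%N) :
  exists eps0 C : R, [/\ 0 < eps0, 0 < C &
    forall eps : R, 0 < eps < eps0 ->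
      exists! w : 'rV[R[i]]_N,
        [/\ fixed_point eps w, real_valued w & near_single_site C eps w]].
Proof.
have C1 : 1 <= (4 ^+ N : R) by rewrite exprn_ege1//; lra.
have C0 : 0 < (4 ^+ N : R) by lra.
(* The constant 4^N dominates every 4^j in (4 * eps)^j. The threshold gives 4^N * eps < 1/64, so
   each candidate lies in the uniqueness ball, and also eps <= 1/64 for existence. *)
exists (64 * 4 ^+ N)^-1, (4 ^+ N); split=> //.
move=> eps /andP[e0]; rewrite -[_^-1]mul1r ltr_pdivlMr ?mulr_gt0// => eC.
have e64 : eps <= 1/64.
  by have : eps * 1 <= eps * 4 ^+ N by [rewrite ler_pM2l]; lra.
have fixE (x : 'rV[R]_N) : fixed_point eps (map_mx (real_complex R) x) <->
    forall j, residual eps x j = 0.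
  rewrite fixed_pointP; split=> h j; last by rewrite dnls_rhs_real h.
  by have := h j; rewrite dnls_rhs_real => /(@complexI R).
have nearE (x : 'rV[R]_N) :
    near_single_site (4 ^+ N) eps (map_mx (real_complex R) x) <->
    forall j, `|x ord0 j - one_site R j| <= 4 ^+ N * eps ^+ maxn 1 j.
  have E (j : 'I_N) : (if j == 0%N :> nat
        then `|(map_mx (real_complex R) x) ord0 j - 1| <= (4 ^+ N * eps)%:C
        else `|(map_mx (real_complex R) x) ord0 j| <= (4 ^+ N * eps ^+ j)%:C) =
      (`|x ord0 j - one_site R j| <= 4 ^+ N * eps ^+ maxn 1 j).
    rewrite /one_site; case: (eqVneq (j : nat) 0%N) => [->|jN0].
      by rewrite !mxE -(rmorph1 (real_complex R)) -rmorphB normc_real lecR.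
    rewrite !mxE normc_real lecR subr0 (_ : maxn 1 j = j)//; lia.
  by split=> h j; [rewrite -E; exact: h|rewrite E].
have small (x : 'rV[R]_N) :
    (forall j, `|x ord0 j - one_site R j| <= 4 ^+ N * eps ^+ maxn 1 j) ->
    forall j, `|x ord0 j - one_site R j| <= 1/8.
  move=> h j; apply: (le_trans (h j)).
  have : 4 ^+ N * eps ^+ maxn 1 j <= 4 ^+ N * eps ^+ 1.
    by rewrite ler_pM2l// ler_wiXn2l// ?leq_maxl//; lra.
  by rewrite expr1; lra.
have [x xbox x0] := residual0_exists N (introT andP (conj e0 e64)).
have xnear j : `|x ord0 j - one_site R j| <= 4 ^+ N * eps ^+ maxn 1 j.
  apply: (le_trans (xbox j)); rewrite exprMn ler_wpM2r//.
    by rewrite exprn_ge0// ltW.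
  by rewrite ler_weXn2l//; [lra|have := ltn_ord j; lia].
exists (map_mx (real_complex R) x); split.
  split; [exact/fixE|by move=> j; rewrite mxE|exact/nearE].
move=> w [wfix wreal wnear].
(* A real-valued competitor is the image of its real part, so uniqueness over the reals suffices. *)
have wE : w = map_mx (real_complex R) (map_mx (@complex.Re R) w).
  by apply/rowP => j; rewrite !mxE; have := wreal j; case: (w ord0 j) => a b /= ->.
rewrite wE in wfix wnear *; congr map_mx.
apply: (@residual0_unique R N eps) => //; first by lra.
- exact: small.
- by apply/small/nearE.
- exact/fixE.
Qed.
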